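(* Let $(\mathcal S,\mathcal Q,\Theta)$ be a Pufferfish scenario, $(\mathcal U,\omega)$ a continuous or finite slice profile, $\alpha>1$, $\epsilon>0$, and $f:\mathcal X\to\mathbb R^d$ a query. Let $\Delta_\star^2:=\sup_{u\in\mathcal U}(\Delta^u_\infty)^2$. Then the mechanism $\mathcal M(X)=f(X)+N$, with $N\sim\mathcal N\!\left(0,\frac{\alpha\Delta_\star^2}{2\epsilon}I_d\right)$ independent of $X$, satisfies $(\alpha,\epsilon,\omega)$-Joint-SRPP in $(\mathcal S,\mathcal Q,\Theta)$.
   Context: Pufferfish scenario: secrets $\mathcal S$, pairs $\mathcal Q\subseteq\mathcal S\times\mathcal S$, priors $\Theta$; each $\theta$ is a joint law of secret $S$ and dataset $X$, with secret marginal $P^S_\theta$. $P^{f,s}_\theta$ is the law of $f(X)$ given $S=s$ under $\theta$; $\mathcal M^\theta_s$ the law of $\mathcal M(X)$ given $S=s$ under $\theta$. Slice profile $(\mathcal U,\omega)$: $\mathcal U\subseteq\mathbb S^{d-1}$, $\omega$ a probability measure on $\mathbb S^{d-1}$ supported on $\mathcal U$. $\Psi^u(a)=\langle a,u\rangle$; $\Psi^u_\#$ pushforward. $W_\infty(\nu,\mu)=\inf_{\pi\in\Pi(\nu,\mu)}\sup_{(x,y)\in\mathrm{supp}\,\pi}|x-y|$ for measures on $\mathbb R$. $\Delta^u_\infty:=\max_{(s_i,s_j)\in\mathcal Q,\theta\in\Theta}W_\infty(\Psi^u_\#P^{f,s_i}_\theta,\Psi^u_\#P^{f,s_j}_\theta)$.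 R\'enyi divergence $\mathtt D_\alpha(P\|Q)=\frac1{\alpha-1}\log\mathbb E_Q[(dP/dQ)^\alpha]$. $\mathtt{JSD}^\omega_\alpha(P\|Q)=\frac1{\alpha-1}\log\int\exp((\alpha-1)\mathtt D_\alpha(\Psi^u_\#P\|\Psi^u_\#Q))\,d\omega(u)$. $\mathcal M$ is $(\alpha,\epsilon,\omega)$-Joint-SRPP in $(\mathcal S,\mathcal Q,\Theta)$ if $\mathtt{JSD}^\omega_\alpha(\mathcal M^\theta_{s_i}\|\mathcal M^\theta_{s_j})\le\epsilon$ for all $\theta\in\Theta$ and $(s_i,s_j)\in\mathcal Q$ with $P^S_\theta(s_i),P^S_\theta(s_j)>0$. *)

(* Defs.v *)
(* R^d is modelled as d.-tuple R with its
   canonical product (= Borel) sigma-algebra from measurable_structure.v. *)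
From HB Require Import structures.
From mathcomp Require Import all_boot all_order all_algebra.
From mathcomp Require Import all_classical all_reals all_analysis.
From mathcomp Require Import measurable_realfun normal_distribution.
Set Implicit Arguments. Unset Strict Implicit. Unset Printing Implicit Defensive.
Import Order.TTheory GRing.Theory Num.Theory.
Import numFieldNormedType.Exports.
Local Open Scope classical_set_scope.
Local Open Scope ring_scope.

Section pufferfish.
Context {R : realType}.

Definition inner (d : nat) (a u : d.-tuple R) : R :=
  \sum_(i < d) tnth a i * tnth u i.
Definition Psi (d : nat) (u : d.-tuple R) (a : d.-tuple R) : R := inner a u.
Definition addv (d : nat) (a b : d.-tuple R) : d.-tuple R :=
  [tuple tnth a i + tnth b i | i < d].
Definition sphere (d : nat) : set (d.-tuple R) :=
  [set u | \sum_(i < d) tnth u i ^+ 2 = 1].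

Local Open Scope ereal_scope.
Definition densities dT (T : measurableType dT) (P Q : set T -> \bar R)
  : set (T -> \bar R) :=
  [set h : T -> \bar R | [/\ measurable_fun setT h, (forall x, 0 <= h x) &
           forall A, measurable A -> P A = \int[Q]_(x in A) h x]].
(* E_Q[(dP/dQ)^alpha]; = +oo when P is not absolutely continuous w.r.t. Q
   (no density exists, inf of the empty set); densities agree Q-a.e. *)
Definition renyi_moment dT (T : measurableType dT) (alpha : R)
  (P Q : set T -> \bar R) : \bar R :=
  ereal_inf ((fun h : T -> \bar R => \int[Q]_x poweR (h x) alpha) @` densities P Q).
Definition renyi dT (T : measurableType dT) (alpha : R)
  (P Q : set T -> \bar R) : \bar R :=
  ((alpha - 1)^-1)%:E * lne (renyi_moment alpha P Q).

Definition JSD (d : nat) (alpha : R) (omega : set (d.-tuple R) -> \bar R)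
  (P Q : set (d.-tuple R) -> \bar R) : \bar R :=
  ((alpha - 1)^-1)%:E *
  lne (\int[omega]_u expeR ((alpha - 1)%:E *
        renyi alpha (pushforward P (Psi u)) (pushforward Q (Psi u)))).

Definition couplings (nu mu : set R -> \bar R) : set (probability (R * R)%type R) :=
  [set pi | forall A : set R, measurable A ->
     pi (A `*` setT) = nu A /\ pi (setT `*` A) = mu A].
Definition msupp (pi : set (R * R)%type -> \bar R) : set (R * R)%type :=
  [set z | forall V : set (R * R)%type, open V -> V z -> 0 < pi V].
Definition W_inf (nu mu : set R -> \bar R) : \bar R :=
  ereal_inf [set ereal_sup [set (`|z.1 - z.2|)%:E | z in msupp pi]
            | pi in couplings nu mu].

Context {dS dX : measure_display} {S : measurableType dS} {X : measurableType dX}.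

Definition PS (theta : probability (S * X)%type R) (s : S) : \bar R :=
  theta ([set s] `*` setT).
Definition cond_law (theta : probability (S * X)%type R) (s : S) : set X -> \bar R :=
  fun A => (fine (theta ([set s] `*` A)) / fine (PS theta s))%:E.
Definition query_law (d : nat) (f : X -> d.-tuple R)
  (theta : probability (S * X)%type R) (s : S) : set (d.-tuple R) -> \bar R :=
  pushforward (cond_law theta s) f.

Definition Delta_inf (d : nat) (Q : set (S * S)%type)
  (Theta : set (probability (S * X)%type R)) (f : X -> d.-tuple R)
  (u : d.-tuple R) : \bar R :=
  ereal_sup [set w | exists theta si sj,
     [/\ Theta theta, Q (si, sj), 0 < PS theta si, 0 < PS theta sj &
      w = W_inf (pushforward (query_law f theta si) (Psi u))
                (pushforward (query_law f theta sj) (Psi u))]].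

(* The law of the additive-noise mechanism M(X) = f(X) + N given S = s, where
   N ~ gamma is independent of (S, X). *)
Definition mech_law (d : nat) (f : X -> d.-tuple R) (gamma : set (d.-tuple R) -> \bar R)
  (theta : probability (S * X)%type R) (s : S) : set (d.-tuple R) -> \bar R :=
  fun A => \int[cond_law theta s]_x gamma [set n | A (addv (f x) n)].

(* (alpha, eps, omega)-Joint-SRPP, for a mechanism given by its conditional
   laws Mlaw theta s = M^theta_s *)
Definition joint_SRPP (d : nat) (alpha eps : R) (omega : set (d.-tuple R) -> \bar R)
  (Q : set (S * S)%type) (Theta : set (probability (S * X)%type R))
  (Mlaw : probability (S * X)%type R -> S -> set (d.-tuple R) -> \bar R) : Prop :=
  forall theta si sj, Theta theta -> Q (si, sj) ->
    0 < PS theta si -> 0 < PS theta sj ->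
    JSD alpha omega (Mlaw theta si) (Mlaw theta sj) <= eps%:E.

End pufferfish.

Definition gauss1 {R : realType} (s2 : R) (B : set R) : \bar R :=
  if s2 == 0 then @dirac _ R 0 R B else normal_prob 0 (Num.sqrt s2) B.

(* gamma is N(0, s2 I_d) on R^d: coordinates are independent N(0, s2)
   (product formula on measurable boxes, which determines the measure) *)
Definition is_gaussian_iso {R : realType} (d : nat)
  (gamma : probability (d.-tuple R) R) (s2 : R) : Prop :=
  forall B : 'I_d -> set R, (forall i, measurable (B i)) ->
    gamma [set n | forall i, B i (tnth n i)] = (\prod_(i < d) gauss1 s2 (B i))%E.

(* Main.v *)
(* Fix a direction u of the slice profile. The projection of the isotropic
   Gaussian N(0, s2 I_d) on the unit vector u is N(0, s2), so the u-slice of the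
   mechanism's law is the law of <f(X), u> convolved with N(0, s2). Couple the
   two conditional laws of <f(X), u> by pi with |x - y| <= c on its support. The
   sliced output laws have densities p(z) = E_pi phi(z - x) and
   q(z) = E_pi phi(z - y), and joint convexity of (a, b) |-> a^alpha b^(1-alpha)
   gives p^alpha q^(1-alpha) <= E_pi [phi(z - x)^alpha phi(z - y)^(1-alpha)],
   whose integral in z is E_pi exp(alpha (alpha - 1) (x - y)^2 / (2 s2)).
   The Renyi moment does not depend on pi, so c may decrease to W_infinity and
   no optimal coupling is needed. With s2 = alpha Delta^2 / (2 eps) the bound is
   exp((alpha - 1) eps), uniformly in u, and it survives averaging over omega.
   If Delta = 0 the noise is a Dirac mass and both sliced laws coincide. *)
Require Import Defs.
From HB Require Import structures.
From mathcomp Require Import all_boot all_order all_algebra.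
From mathcomp Require Import all_classical all_reals all_analysis.
From mathcomp Require Import measurable_realfun normal_distribution.
From mathcomp Require Import ring lra.
Import Order.TTheory GRing.Theory Num.Theory.
Import numFieldNormedType.Exports.
Local Open Scope classical_set_scope.
Local Open Scope ring_scope.

(** * Integration against set functions and densities *)

Section integration.
Local Open Scope ereal_scope.
Context {d : measure_display} {T : measurableType d} {R : realType}.
Import HBNNSimple.

(** The integral is built from [sintegral], which evaluates the set function only at measurable
    preimages. This is how bare set functions such as [cond_law] get replaced by genuine
    measures. *)
Lemma eq_setfun_integral (m1 m2 : set T -> \bar R) (D : set T) (f : T -> \bar R) :
  (forall A, measurable A -> m1 A = m2 A) ->
  \int[m1]_(x in D) f x = \int[m2]_(x in D) f x.
Proof.
move=> m12.
have E (h : {nnsfun T >-> R}) : sintegral m1 h = sintegral m2 h.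
  by apply: eq_fsbigr => r _; rewrite m12//; exact: measurable_funPTI.
rewrite /integral; congr (ereal_sup _ - ereal_sup _);
  by apply/seteqP; split => _ [h hf <-]; exists h => //; rewrite E.
Qed.

(** The integral of a nonnegative function is the supremum over the simple functions below it, and
    each of these is at most [c] almost everywhere. This route covers an arbitrary [F], in
    particular the integrand of [JSD] as a function of the direction. *)
Lemma integral_le_full_measure (P : probability T R) (V : set T)
    (F : T -> \bar R) (c : R) :
  measurable V -> P V = 1 -> (forall x, 0 <= F x) -> (0 <= c)%R ->
  (forall x, V x -> F x <= c%:E) -> \int[P]_x F x <= c%:E.
Proof.
move=> mV PV F0 c0 Fc; rewrite ge0_integralTE//; apply: ge_ereal_sup => _ [h hF <-].
have -> : sintegral P h = \int[P]_x (h x)%:E.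
  by rewrite integral_nnsfun// patch_setT.
apply: (@le_trans _ _ (\int[P]_x (cst c%:E x))).
  apply: ae_ge0_le_integral => //.
  - by move=> x _; rewrite lee_fin.
  - exact/measurable_EFinP/measurable_funP.
  exists (~` V); split; first exact: measurableC.
    by have := probability_setC P mV; rewrite PV subee.
  move=> x /= nhc Vx; apply: nhc => _.
  exact: le_trans (hF x) (Fc x Vx).
by rewrite integral_cst// [X in _ * X](probability_setT P) mule1.
Qed.

(** Indicators are the hypothesis; simple functions follow by linearity, and [F] by monotone
    convergence along [nnsfun_approx]. *)
Lemma ge0_integral_density (nu mu : {measure set T -> \bar R})
    (q : T -> R) (F : T -> \bar R) :
  measurable_fun setT q -> (forall x, 0 <= q x)%R ->
  (forall A, measurable A -> nu A = \int[mu]_(x in A) (q x)%:E) ->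
  measurable_fun setT F -> (forall x, 0 <= F x) ->
  \int[nu]_x F x = \int[mu]_x (F x * (q x)%:E).
Proof.
move=> mq' q0' nuE mF F0.
have mq : measurable_fun setT (EFin \o q) by exact/measurable_EFinP.
have q0 x : 0 <= (q x)%:E by rewrite lee_fin.
have ind_int A : measurable A ->
    \int[nu]_x (\1_A x)%:E = \int[mu]_x ((\1_A x)%:E * (q x)%:E).
  move=> mA; rewrite integral_indic// setIT nuE// integral_mkcond.
  apply: eq_integral => x _; rewrite patchE indicE.
  by case: (x \in A); rewrite ?mul1e ?mul0e.
pose h := nnsfun_approx measurableT mF.
have hE n : \int[nu]_x (h n x)%:E = \int[mu]_x ((h n x)%:E * (q x)%:E).
  under eq_integral do rewrite fimfunE// -fsumEFin//.
  rewrite ge0_integral_fsum//; first last.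
  - by move=> r x _; rewrite nnfun_muleindic_ge0.
  - by move=> r; exact/measurable_EFinP/measurable_funM.
  transitivity (\int[mu]_x (\sum_(r \in range (h n))
      (r%:E * (\1_(h n @^-1` [set r]) x)%:E * (q x)%:E))); last first.
    apply: eq_integral => x _; rewrite -ge0_mule_fsuml; last first.
      by move=> r; rewrite nnfun_muleindic_ge0.
    congr (_ * _); rewrite [in RHS]fimfunE -fsumEFin//.
  rewrite ge0_integral_fsum//; first last.
  - by move=> r x _; rewrite mule_ge0// nnfun_muleindic_ge0.
  - by move=> r; apply: emeasurable_funM => //; exact/measurable_EFinP/measurable_funM.
  apply: eq_fsbigr => r; rewrite inE => -[x _ hxr].
  have r0 : (0 <= r)%R by rewrite -hxr.
  have mhr : measurable (h n @^-1` [set r]) by exact: measurable_funPTI.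
  under eq_integral do rewrite EFinM.
  rewrite ge0_integralZl//; last exact/measurable_EFinP.
  under [RHS]eq_integral do rewrite -muleA.
  rewrite ge0_integralZl//; first by rewrite ind_int.
  - by apply: emeasurable_funM => //; exact/measurable_EFinP.
  - by move=> y _; rewrite mule_ge0// lee_fin.
transitivity (limn (fun n => \int[nu]_x (h n x)%:E)).
  rewrite -monotone_convergence//.
  - apply: eq_integral => x _; apply/esym/cvg_lim => //.
    exact: cvg_nnsfun_approx.
  - by move=> n; exact/measurable_EFinP/measurable_funP.
  - by move=> n x _; rewrite lee_fin.
  - by move=> x _ m n mn; rewrite lee_fin; exact/lefP/nd_nnsfun_approx.
under eq_fun do rewrite hE.
rewrite -monotone_convergence//.
- apply: eq_integral => x _; apply/cvg_lim => //.
  apply: cvgeZr => //.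
  exact: cvg_nnsfun_approx.
- by move=> n; apply: emeasurable_funM => //; exact/measurable_EFinP/measurable_funP.
- by move=> n x _; rewrite mule_ge0// lee_fin.
- move=> x _ m n mn; rewrite lee_wpmul2r// lee_fin.
  exact/lefP/nd_nnsfun_approx.
Qed.
End integration.

(** * Image measures *)

Section image_measure.
Context {d1 d2 : measure_display} {T1 : measurableType d1} {T2 : measurableType d2}
  {R : realType}.

(* The library's measure structure on [pushforward m f] leaves the proof that
   [f] is measurable as an unresolved argument; here it is part of the term. *)
Definition image_measure (m : {measure set T1 -> \bar R}) (f : T1 -> T2)
    (mf : measurable_fun setT f) : set T2 -> \bar R := pushforward m f.

Let image_measure_semi_sigma_additive m f mf :
  semi_sigma_additive (image_measure m f mf).
Proof.
exact: (@measure_semi_sigma_additive _ _ _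
  (@measure_function_pushforward__canonical__measure_function_Measure
    _ _ _ _ _ m f mf)).
Qed.

Let image_measure0 m f mf : image_measure m f mf set0 = 0%E.
Proof. exact: measure0. Qed.

Let image_measure_ge0 m f mf A : (0 <= image_measure m f mf A)%E.
Proof. exact: measure_ge0. Qed.

HB.instance Definition _ m f mf := isMeasure.Build _ _ _ (image_measure m f mf)
  (image_measure0 m f mf) (image_measure_ge0 m f mf)
  (@image_measure_semi_sigma_additive m f mf).

Definition image_prob (P : probability T1 R) (f : T1 -> T2)
  (mf : measurable_fun setT f) : set T2 -> \bar R := image_measure P f mf.

HB.instance Definition _ P f mf := Measure.on (image_prob P f mf).

Let image_prob_setT P f mf : image_prob P f mf setT = 1%E.
Proof. exact: probability_setT. Qed.

HB.instance Definition _ P f mf := Measure_isProbability.Build _ _ _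
  (image_prob P f mf) (image_prob_setT P f mf).
End image_measure.

(** * Normal laws under affine maps *)

Section normal.
Local Open Scope ereal_scope.
Context {R : realType}.
Notation leb := (@lebesgue_measure R).
Implicit Types (x v s : R) (A : set R).

Lemma measurable_affine x v : measurable_fun setT (fun t : R => x + v * t)%R.
Proof. by apply: measurable_funD => //; exact: measurable_funM. Qed.

(** By uniqueness of Lebesgue measure it suffices to compare half-open intervals; for [v < 0] the
    preimage has its closed end on the left, which leaves the length unchanged. *)
Lemma lebesgue_measure_affine x v A : v != 0%R -> measurable A ->
  leb A = (`|v|%R)%:E * leb [set t | A (x + v * t)%R].
Proof.
move=> v0 mA.
pose phi (t : measurableTypeR R) : measurableTypeR R := (x + v * t)%R.
have mphi : measurable_fun setT phi by exact: measurable_affine.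
pose m : {measure set (measurableTypeR R) -> \bar R} :=
  mscale (NngNum (normr_ge0 v)) (image_measure leb phi mphi).
suff H X : ocitv X -> leb X = m X by exact: (@lebesgue_measure_unique R m H).
case=> -[a b] _ <-.
change (leb `]a, b] = (`|v|%R)%:E * leb (phi @^-1` `]a, b])).
have [v_lt0|v_gt0|v_eq0] := ltgtP v 0%R; last by rewrite v_eq0 eqxx in v0.
- have -> : phi @^-1` `]a, b] = `[((b - x) / v)%R, ((a - x) / v)%R[%classic.
    apply/seteqP; split => t /=; rewrite !in_itv/= /phi ler_ndivrMr// ltr_ndivlMr//;
      by move=> /andP[? ?]; apply/andP; split; lra.
  rewrite !lebesgue_measure_itv/= !lte_fin ltr_nM2r ?invr_lt0// ltrD2r.
  case: ifPn => _; last by rewrite mule0.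
  rewrite ltr0_norm// -!EFinD -EFinM; congr EFin.
  by field.
- have -> : phi @^-1` `]a, b] = `]((a - x) / v)%R, ((b - x) / v)%R]%classic.
    apply/seteqP; split => t /=; rewrite !in_itv/= /phi ltr_pdivrMr// ler_pdivlMr//;
      by move=> /andP[? ?]; apply/andP; split; lra.
  rewrite !lebesgue_measure_itv/= !lte_fin ltr_pM2r ?invr_gt0// ltrD2r.
  case: ifPn => _; last by rewrite mule0.
  rewrite gtr0_norm// -!EFinD -EFinM; congr EFin.
  by field.
Qed.

(** Change of variable [z = x + v * t] in the density: the factor [|v|] turns the peak for [|v| * s]
    into the peak for [s]. *)
Lemma normal_prob_affine x v s A : v != 0%R -> s != 0%R -> measurable A ->
  normal_prob 0 s [set t | A (x + v * t)%R] = normal_prob x (`|v| * s) A.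
Proof.
move=> v0 s0 mA.
have vs0 : (`|v| * s != 0)%R by rewrite mulf_neq0 ?normr_eq0.
pose phi (t : measurableTypeR R) : measurableTypeR R := (x + v * t)%R.
have mphi : measurable_fun setT phi by exact: measurable_affine.
have mpdf m r : measurable_fun setT (EFin \o normal_pdf m r : R -> \bar R).
  by apply/measurable_EFinP; exact: measurable_normal_pdf.
rewrite /normal_prob [RHS](eq_setfun_integral _
  (mscale (NngNum (normr_ge0 v)) (image_measure leb phi mphi))); last first.
  by move=> B mB; exact: lebesgue_measure_affine.
rewrite ge0_integral_mscale//=; last 2 first.
  by apply: measurable_funTS; exact: mpdf.
  by move=> z _; rewrite lee_fin normal_pdf_ge0.
rewrite ge0_integral_pushforward//=; last 2 first.
  by apply: measurable_funTS; exact: mpdf.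
  by move=> z _; rewrite lee_fin normal_pdf_ge0.
rewrite -ge0_integralZl//=; last 3 first.
- by rewrite -[X in measurable X]setTI; exact: mphi.
- by apply: measurable_funTS; apply: (measurableT_comp (mpdf _ _)).
- by move=> z _; rewrite lee_fin normal_pdf_ge0.
apply: eq_integral => t _; rewrite -EFinM; congr EFin.
rewrite !normal_pdfE// /normal_peak /normal_fun /phi.
have -> : (x + v * t - x = v * t)%R by lra.
rewrite !exprMn real_normK ?num_real// mulrA; congr (_ * expR _)%R.
  have -> : (v ^+ 2 * s ^+ 2 * pi *+ 2 = v ^+ 2 * (s ^+ 2 * pi *+ 2))%R by ring.
  rewrite sqrtrM ?sqr_ge0// sqrtr_sqr invfM mulrA mulfV ?mul1r//.
  by rewrite normr_eq0.
rewrite subr0; field.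
by rewrite s0 v0.
Qed.

Lemma measurable_normal_pdf2 s :
  measurable_fun setT (fun z : R * R => normal_pdf z.1 s z.2).
Proof.
have [->|s0] := eqVneq s 0%R.
  (* At deviation 0, [normal_pdf] takes a default value: an indicator function of the evaluation
     point. *)
  rewrite /normal_pdf eqxx; apply: (measurableT_comp _ measurable_snd).
  exact: measurable_indic.
under eq_fun do rewrite normal_pdfE//.
apply: measurable_funM => //; apply: measurableT_comp => //.
apply: measurable_funM => //; apply: measurableT_comp => //.
by apply: measurable_funX; exact: measurable_funB.
Qed.

Lemma normal_pdf_gt0 m s x : s != 0%R -> (0 < normal_pdf m s x)%R.
Proof.
by move=> s0; rewrite normal_pdfE// mulr_gt0 ?normal_peak_gt0// expR_gt0.
Qed.
End normal.

(** * Mixtures of normal laws *)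

Section normal_mixture.
Local Open Scope ereal_scope.
Context {R : realType} (mu : probability R R) (s : R) (s0 : s != 0%R).
Notation leb := (@lebesgue_measure R).

(** The density of [mu] convolved with [N(0, s^2)], kept real-valued so that ratios and real powers
    can be formed; the integral is finite because [normal_pdf] is bounded by its peak. *)
Definition mixture_pdf (z : R) : R := fine (\int[mu]_x (normal_pdf x s z)%:E).

Lemma measurable_normal_pdf_mean z :
  measurable_fun setT (fun x => (normal_pdf x s z)%:E).
Proof.
apply/measurable_EFinP.
exact: (measurableT_comp (measurable_normal_pdf2 s) (pair2_measurable z)).
Qed.

Lemma mixture_pdfE z : (mixture_pdf z)%:E = \int[mu]_x (normal_pdf x s z)%:E.
Proof.
rewrite fineK// ge0_fin_numE; last first.
  by apply: integral_ge0 => x _; rewrite lee_fin normal_pdf_ge0.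
apply: (@le_lt_trans _ _ (\int[mu]_x (cst (normal_peak s)%:E x))).
  apply: ge0_le_integral => //.
  - by move=> x _; rewrite lee_fin normal_pdf_ge0.
  - exact: measurable_normal_pdf_mean.
  - by move=> x _; rewrite lee_fin normal_pdf_ub.
by rewrite integral_cst// [X in _ * X](probability_setT mu) mule1 ltry.
Qed.

(** A vanishing integral would make the positive integrand zero almost everywhere, so that the whole
    line would be [mu]-null. Positivity everywhere later allows division by a mixture density. *)
Lemma mixture_pdf_gt0 z : (0 < mixture_pdf z)%R.
Proof.
rewrite -lte_fin mixture_pdfE lt_neqAle; apply/andP; split; last first.
  by apply: integral_ge0 => x _; rewrite lee_fin normal_pdf_ge0.
apply/eqP => /esym H0.
have : ae_eq mu setT (fun x => (normal_pdf x s z)%:E) (cst 0).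
  apply/ae_eq_integral_abs => //; first exact: measurable_normal_pdf_mean.
  by apply: (etrans _ H0); apply: eq_integral => x _; rewrite /= ger0_norm// normal_pdf_ge0.
move=> [N [mN N0 sN]].
have NT : N = setT.
  apply/seteqP; split => // x _; apply: sN => /=.
  by move/(_ I)/eqP; rewrite eqe gt_eqF// normal_pdf_gt0.
by move: N0 => /eqP; rewrite NT [X in X == _](probability_setT mu) onee_eq0.
Qed.

Lemma measurable_mixture_pdf : measurable_fun setT mixture_pdf.
Proof.
apply/measurable_EFinP; rewrite (_ : EFin \o _ =
  fun z => \int[mu]_x (normal_pdf x s z)%:E); last first.
  by apply/funext => z; rewrite /= mixture_pdfE.
apply: (measurable_fun_fubini_tonelli_G
  (fun z : R * R => (normal_pdf z.1 s z.2)%:E)).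
- by apply/measurable_EFinP; exact: measurable_normal_pdf2.
- by move=> z; rewrite lee_fin normal_pdf_ge0.
Qed.

Let g (A : set R) (z : R * R) : \bar R := (normal_pdf z.1 s z.2 * \1_A z.2)%:E.

Let g0 A z : 0 <= g A z.
Proof. by rewrite lee_fin mulr_ge0 ?normal_pdf_ge0. Qed.

Let mg A : measurable A -> measurable_fun setT (g A).
Proof.
move=> mA; apply/measurable_EFinP; apply: measurable_funM.
  exact: measurable_normal_pdf2.
by apply: (measurableT_comp _ measurable_snd); exact: measurable_indic.
Qed.

Let normal_probE A x : normal_prob x s A = \int[leb]_z g A (x, z).
Proof.
rewrite /normal_prob integral_mkcond; apply: eq_integral => z _.
by rewrite patchE /g/= indicE; case: (z \in A); rewrite ?mulr1 ?mulr0.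
Qed.

Lemma measurable_normal_prob A : measurable A ->
  measurable_fun setT (fun x => normal_prob x s A).
Proof.
move=> mA; under eq_fun do rewrite normal_probE.
exact: (@measurable_fun_fubini_tonelli_F _ _ R (measurableTypeR R) R leb (g A) (mg _ mA) (g0 A)).
Qed.

(** Tonelli, once the restriction to [A] has been moved into the integrand as [\1_A]. *)
Lemma mixture_density A : measurable A ->
  \int[mu]_x normal_prob x s A = \int[leb]_(z in A) (mixture_pdf z)%:E.
Proof.
move=> mA; under eq_integral do rewrite normal_probE.
rewrite (@fubini_tonelli _ _ R (measurableTypeR R) R mu leb (g A) (mg _ mA) (g0 A)).
rewrite [RHS]integral_mkcond; apply: eq_integral => z _.
rewrite patchE /g/= indicE mixture_pdfE; case: (z \in A).
  by apply: eq_integral => x _; rewrite mulr1.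
by apply: integral0_eq => x _; rewrite mulr0.
Qed.

End normal_mixture.

(* [R] and [measurableTypeR R] have the same measurable sets but distinct
   displays, hence the transport along the identity. *)
Lemma ge0_integral_lebesgue_density {R : realType} (nu : {measure set R -> \bar R})
    (q : R -> R) (F : R -> \bar R) :
  measurable_fun setT q -> (forall x, 0 <= q x) ->
  (forall A, measurable A ->
    nu A = \int[@lebesgue_measure R]_(x in A) (q x)%:E)%E ->
  measurable_fun setT F -> (forall x, 0 <= F x)%E ->
  (\int[nu]_x F x = \int[@lebesgue_measure R]_x (F x * (q x)%:E))%E.
Proof.
move=> mq q0 nuE mF F0.
have mid : measurable_fun setT (id : R -> measurableTypeR R).
  by move=> _ B mB; rewrite setTI.
transitivity (\int[image_measure nu (id : R -> measurableTypeR R) mid]_x F x)%E.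
  by rewrite (ge0_integral_pushforward mid).
exact: ge0_integral_density.
Qed.

(** * The possibly degenerate centred Gaussian as a probability *)

Section gauss1_prob.
Context {R : realType}.

Lemma gauss1_normal (s2 : R) : 0 < s2 -> gauss1 s2 = normal_prob 0 (Num.sqrt s2).
Proof. by move=> s20; apply/funext => A; rewrite /gauss1 gt_eqF. Qed.

Lemma gauss1_dirac : gauss1 (0 : R) = @dirac _ R 0 R.
Proof. by apply/funext => A; rewrite /gauss1 eqxx. Qed.

Let gauss1_cases (P : (set R -> \bar R) -> Prop) (s2 : R) :
  P (@dirac _ R 0 R) -> P (normal_prob 0 (Num.sqrt s2)) -> P (gauss1 s2).
Proof.
have [->|s20] := eqVneq s2 0; first by rewrite gauss1_dirac.
rewrite (_ : gauss1 s2 = normal_prob 0 (Num.sqrt s2))//.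
by apply/funext => A; rewrite /gauss1 (negbTE s20).
Qed.

Let gauss1_set0 (s2 : R) : gauss1 s2 set0 = 0%E.
Proof.
by apply: (gauss1_cases (fun g => g set0 = 0%E)); exact: measure0.
Qed.

Let gauss1_ge0 (s2 : R) A : (0 <= gauss1 s2 A)%E.
Proof.
by apply: (gauss1_cases (fun g => 0 <= g A)%E); exact: measure_ge0.
Qed.

Let gauss1_semi_sigma_additive (s2 : R) : semi_sigma_additive (gauss1 s2).
Proof.
apply: (gauss1_cases (@semi_sigma_additive _ R R)).
  exact: (@measure_semi_sigma_additive _ _ _ (@dirac _ R 0 R)).
exact: (@measure_semi_sigma_additive _ _ _ (normal_prob 0 (Num.sqrt s2))).
Qed.

HB.instance Definition _ (s2 : R) := isMeasure.Build _ _ _ (gauss1 s2)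
  (gauss1_set0 s2) (gauss1_ge0 s2) (@gauss1_semi_sigma_additive s2).

Let gauss1_setT (s2 : R) : gauss1 s2 setT = 1%E.
Proof.
apply: (gauss1_cases (fun g => g setT = 1%E)); last exact: probability_setT.
by rewrite diracT.
Qed.

HB.instance Definition _ (s2 : R) := Measure_isProbability.Build _ _ _
  (gauss1 s2) (gauss1_setT s2).
End gauss1_prob.

(** * Convolution of centred normal laws *)

Section normal_convolution.
Local Open Scope ereal_scope.
Context {R : realType}.
Notation leb := (@lebesgue_measure R).

Lemma normal_convolution (a b : R) (A : set R) :
  (0 < a)%R -> (0 < b)%R -> measurable A ->
  \int[gauss1 a]_x normal_prob x (Num.sqrt b) A = gauss1 (a + b) A.
Proof.
move=> a0 b0 mA; set s1 := Num.sqrt a; set s2 := Num.sqrt b.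
have ab0 : (0 < a + b)%R by exact: addr_gt0.
have s10 : s1 != 0%R by rewrite gt_eqF ?sqrtr_gt0.
have s20 : s2 != 0%R by rewrite gt_eqF ?sqrtr_gt0.
rewrite mixture_density// gauss1_normal// /normal_prob.
set s := Num.sqrt _.
have s_gt0 : (0 < s)%R by rewrite sqrtr_gt0.
have s2E : (s ^+ 2 = s1 ^+ 2 + s2 ^+ 2)%R by rewrite !sqr_sqrtr// ltW.
have sn0 : s != 0%R by rewrite gt_eqF.
apply: eq_integral => z _; rewrite mixture_pdfE//.
rewrite (@ge0_integral_lebesgue_density _ _ (normal_pdf 0 s1))//; last 5 first.
- exact: measurable_normal_pdf.
- by move=> x; exact: normal_pdf_ge0.
- by move=> B mB; rewrite /= gauss1_normal.
- exact: measurable_normal_pdf_mean.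
- by move=> x; rewrite lee_fin normal_pdf_ge0.
(* [t] and the [m] below are the deviation and mean of the first summand given that the sum is [z].
   The product of densities then factors as in Bayes' formula, and the conditional density
   integrates to 1. *)
pose t := (`|s1 * s2| / s)%R.
have tn0 : t != 0%R by rewrite mulf_neq0 ?invr_eq0// normr_eq0 mulf_neq0.
(* completing the square in x *)
pose m := (z * s1 ^+ 2 / s ^+ 2)%R.
have E x : (normal_pdf x s2 z * normal_pdf 0 s1 x =
            normal_pdf 0 s z * normal_pdf m t x)%R.
  rewrite !normal_pdfE// mulrACA [RHS]mulrACA; congr (_ * _)%R.
    rewrite /normal_peak -!invfM -!sqrtrM; last 2 first.
    - by rewrite mulrn_wge0// mulr_ge0 ?sqr_ge0 ?pi_ge0.
    - by rewrite mulrn_wge0// mulr_ge0 ?sqr_ge0 ?pi_ge0.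
    congr ((Num.sqrt _)^-1)%R; rewrite /t exprMn exprVn real_normK ?num_real//.
    by field.
  rewrite /normal_fun -!expRD; congr expR.
  rewrite /t exprMn exprVn real_normK ?num_real// /m s2E.
  by field; rewrite -s2E expf_neq0// s10 s20.
under eq_integral do rewrite -EFinM E EFinM.
rewrite ge0_integralZl//=; last 3 first.
- by apply/measurable_EFinP; exact: measurable_normal_pdf.
- by move=> x _; rewrite lee_fin normal_pdf_ge0.
- by rewrite lee_fin normal_pdf_ge0.
by rewrite integral_normal_pdf mule1.
Qed.
End normal_convolution.

(** * Affine images and convolutions of [gauss1] *)

Section gauss1_affine.
Local Open Scope ereal_scope.
Context {R : realType}.
Implicit Types (a b v x : R) (A : set R).

Lemma gauss1_affine x v b A : v != 0%R -> (0 < b)%R -> measurable A ->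
  gauss1 b [set t | A (x + v * t)%R] = normal_prob x (Num.sqrt (v ^+ 2 * b)) A.
Proof.
move=> v0 b0 mA.
have E : Num.sqrt (v ^+ 2 * b) = (`|v| * Num.sqrt b)%R.
  by rewrite sqrtrM ?sqr_ge0// sqrtr_sqr.
have sb0 : Num.sqrt b != 0%R by rewrite gt_eqF// sqrtr_gt0.
rewrite (gauss1_normal b b0) E.
exact (normal_prob_affine x v _ A v0 sb0 mA).
Qed.

(** Either [v = 0] or the law is a Dirac mass at 0; in both cases [v * t] vanishes almost surely. *)
Lemma gauss1_affine_degenerate x v b A : (v ^+ 2 * b = 0)%R ->
  gauss1 b [set t | A (x + v * t)%R] = (\1_A x)%:E.
Proof.
move=> /eqP; rewrite mulf_eq0 sqrf_eq0 => /orP[] /eqP ->.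
  have -> : [set t | A (x + 0 * t)%R] = if x \in A then setT else set0.
    case: ifPn => [/set_mem xA|/negP xA]; apply/seteqP; split=> t //=; rewrite mul0r addr0//.
    by move=> /mem_set.
  by rewrite indicE; case: ifPn => _; [exact: probability_setT|exact: measure0].
rewrite gauss1_dirac diracE indicE; congr (nat_of_bool _)%:R%:E.
by apply/idP/idP => /set_mem/= H; apply/mem_set; rewrite /= ?mulr0 ?addr0//;
  move: H; rewrite ?mulr0 ?addr0.
Qed.

(** If [v ^+ 2 * b = 0] the kernel is an indicator and [gauss1 a] remains; if [a = 0] the kernel is
    evaluated at 0; otherwise this is [normal_convolution]. *)
Lemma gauss1_convolution a b v A : (0 <= a)%R -> (0 <= b)%R -> measurable A ->
  \int[gauss1 a]_x gauss1 b [set t | A (x + v * t)%R] = gauss1 (a + v ^+ 2 * b) A.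
Proof.
move=> a0 b0 mA.
have [vb0|vb0] := eqVneq (v ^+ 2 * b)%R 0%R.
  under eq_integral do rewrite gauss1_affine_degenerate//.
  rewrite vb0 addr0.
  have -> : \int[gauss1 a]_x (\1_A x)%:E = gauss1 a (A `&` setT).
    exact (integral_indic (gauss1 a) measurableT mA).
  by rewrite setIT.
have v0 : v != 0%R by apply: contra_neq vb0 => ->; rewrite expr0n mul0r.
have {}b0 : (0 < b)%R.
  by rewrite lt_neqAle b0 andbT; apply: contra_neq vb0 => <-; rewrite mulr0.
have {}vb0 : (0 < v ^+ 2 * b)%R by rewrite mulr_gt0// exprn_even_gt0.
under eq_integral do rewrite gauss1_affine//.
have [->|an0] := eqVneq a 0%R; last first.
  by rewrite normal_convolution// lt_neqAle eq_sym an0.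
rewrite (eq_setfun_integral _ (@dirac _ R 0%R R)); last first.
  by move=> B _; rewrite /= gauss1_dirac.
rewrite integral_dirac//; last first.
  by apply: measurable_normal_prob => //; rewrite gt_eqF// sqrtr_gt0.
by rewrite diracT mul1e add0r gauss1_normal.
Qed.
End gauss1_affine.

(** * Projections of an isotropic Gaussian vector *)

Section gaussian_projection.
Local Open Scope ereal_scope.
Context {R : realType} (d : nat) (gamma : probability (d.-tuple R) R) (s2 : R).
Hypotheses (s2_ge0 : (0 <= s2)%R) (gammaE : is_gaussian_iso gamma s2).
Variable u : d.-tuple R.

Let partial (k : nat) (n : d.-tuple R) : R :=
  (\sum_(i < d | (i < k)%N) tnth n i * tnth u i)%R.

Let var (k : nat) : R := (s2 * \sum_(i < d | (i < k)%N) tnth u i ^+ 2)%R.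

Lemma measurable_sum_tnth (P : pred 'I_d) :
  measurable_fun setT (fun n : d.-tuple R =>
    \sum_(i < d | P i) tnth n i * tnth u i)%R.
Proof.
under eq_fun do rewrite -big_filter.
apply: measurable_sum => i; apply: measurable_funM => //.
exact: measurable_tnth.
Qed.

Let var_ge0 k : (0 <= var k)%R.
Proof. by rewrite mulr_ge0// sumr_ge0// => i _; exact: sqr_ge0. Qed.

Let tail k (B : 'I_d -> set R) : set (d.-tuple R) :=
  [set n | forall i : 'I_d, (k <= i)%N -> B i (tnth n i)].

Let measurable_tail k B : (forall i, measurable (B i)) -> measurable (tail k B).
Proof.
move=> mB; have -> : tail k B =
    \bigcap_(i in [set i : 'I_d | (k <= i)%N]) (@tnth d R ^~ i @^-1` B i).
  by apply/seteqP; split => n /= H i ki; exact: H.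
apply: fin_bigcap_measurable => // i _.
by rewrite -[X in measurable X]setTI; apply: measurable_tnth.
Qed.

(** Induction on the number [k] of coordinates already summed. Carrying boxes on the remaining
    coordinates keeps the independence of the partial sum from the coordinates still to come, which
    the product formula on boxes provides at [k = 0]. *)
Lemma partial_gaussian k A (B : 'I_d -> set R) : (k <= d)%N -> measurable A ->
    (forall i, measurable (B i)) ->
  gamma (partial k @^-1` A `&` tail k B) =
  gauss1 (var k) A * \prod_(i < d | (k <= i)%N) gauss1 s2 (B i).
Proof.
elim: k A B => [|k IH] A B kd mA mB.
  rewrite /var big_pred0// mulr0 gauss1_dirac diracE.
  have -> : partial 0 @^-1` A = if 0%R \in A then setT else set0.
    by case: ifPn => [/set_mem|/negP] H; apply/seteqP; split=> n //=;
      rewrite /partial big_pred0// => /mem_set.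
  case: ifPn => _; last by rewrite set0I measure0 mul0e.
  rewrite setTI mul1e -gammaE//.
  by congr (gamma _); apply/seteqP; split=> [n /= H i|n /= H i _]; exact: H.
pose j := Ordinal kd.
have partialS n : partial k.+1 n = (partial k n + tnth u j * tnth n j)%R.
  rewrite /partial (bigD1 j)/= ?ltnSn// addrC; congr (_ + _)%R; last exact: mulrC.
  apply: eq_bigl => i; rewrite ltnS ltn_neqAle andbC; congr (_ && _).
have varS : var k.+1 = (var k + tnth u j ^+ 2 * s2)%R.
  rewrite /var (bigD1 j)/= ?ltnSn// mulrDr addrC [(s2 * tnth u j ^+ 2)%R]mulrC.
  congr (s2 * _ + _)%R.
  by apply: eq_bigl => i; rewrite ltnS ltn_neqAle andbC.
set c := \prod_(i < d | (k < i)%N) gauss1 s2 (B i).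
have c0 : 0 <= c by apply: prode_ge0 => i _; exact: measure_ge0.
have cfin : c \is a fin_num.
  by apply: prode_fin_num => i _; exact: fin_num_measure.
have c0' : (0 <= fine c)%R by exact: fine_ge0.
have mE : measurable (tail k.+1 B) by exact: measurable_tail.
have mpair : measurable_fun setT (fun n => (partial k n, tnth n j)).
  apply: measurable_fun_pair; first exact: measurable_sum_tnth.
  exact: measurable_tnth.
(* Joint law of the partial sum and coordinate [j], restricted to the tail event of mass [c]. By
   [mrect] it agrees on rectangles with [c] times a product measure, hence everywhere by uniqueness
   of product measures. *)
pose m := image_measure (mrestr gamma mE) _ mpair.
have mrect (C D : set R) : measurable C -> measurable D ->
    m (C `*` D) = mscale (NngNum c0') (gauss1 (var k)) C * gauss1 s2 D.
  (* Coordinate [j] joins the boxes, so that the induction hypothesis at [k] applies. *)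
  move=> mC mD; pose B' i := if i == j then D else B i.
  transitivity (gamma (partial k @^-1` C `&` tail k B')).
    rewrite /m /image_measure /pushforward /= /mrestr; congr (gamma _).
    apply/seteqP; split => [n [[/= Cn Dn] H]|n [Cn H]]; split => //.
    - move=> i ki; rewrite /B'; case: eqP => [->//|/eqP ij].
      by apply: H; rewrite ltn_neqAle ki andbT eq_sym.
    - by split => //=; have := H j (leqnn k); rewrite /B' eqxx.
    - move=> i ki; have := H i (ltnW ki); rewrite /B'; case: eqP => // ij.
      by move: ki; rewrite ij ltnn.
  rewrite IH//; [|exact: ltnW|by move=> i; rewrite /B'; case: ifP].
  rewrite (bigD1 j)//= {1}/B' eqxx /mscale/= fineK//.
  rewrite (_ : \prod_(i < d | _) _ = c); last first.
    rewrite /c; apply: congr_big => //= [i|i /andP[_ ij]]; last by rewrite /B' (negbTE ij).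
    by rewrite ltn_neqAle andbC eq_sym.
  move: (gauss1 (var k) C) (gauss1 s2 D) => p q.
  by rewrite muleA muleC muleA.
pose sumset := [set z : R * R | A (z.1 + tnth u j * z.2)%R].
have msumset : measurable sumset.
  rewrite -[X in measurable X]setTI.
  have mf : measurable_fun setT (fun z : R * R => z.1 + tnth u j * z.2)%R.
    by apply: measurable_funD => //; exact: measurable_funM.
  exact: mf.
transitivity (m sumset).
  rewrite /m /image_measure /pushforward /= /mrestr; congr (gamma (_ `&` _)).
  by apply/seteqP; split => n /=; rewrite /sumset/= partialS.
refine (etrans (esym (product_measure_unique mrect msumset)) _).
have I : \int[gauss1 (var k)]_x (gauss1 s2 \o xsection sumset) x =
    gauss1 (var k.+1) A.
  rewrite varS.
  refine (etrans _ (gauss1_convolution (var k) s2 (tnth u j) A (var_ge0 k) s2_ge0 mA)).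
  apply: eq_integral => x _ /=; congr (gauss1 s2 _).
  by apply/seteqP; split => t; rewrite /xsection/= inE.
have J : \int[mscale (NngNum c0') (gauss1 (var k))]_x
    (gauss1 s2 \o xsection sumset) x =
    (fine c)%:E * \int[gauss1 (var k)]_x (gauss1 s2 \o xsection sumset) x.
  apply: ge0_integral_mscale => //.
  exact: measurable_fun_xsection.
refine (etrans J _).
by rewrite I (fineK cfin) muleC.
Qed.

Lemma gaussian_projection A : measurable A ->
  gamma [set n | A (Psi u n)] = gauss1 (s2 * \sum_(i < d) tnth u i ^+ 2)%R A.
Proof.
move=> mA.
have := partial_gaussian d A (fun=> setT) (leqnn d) mA (fun=> measurableT).
rewrite big_pred0; last by move=> i; rewrite leqNgt ltn_ord.
rewrite mule1 /var (eq_bigl xpredT); last by move=> i; rewrite ltn_ord.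
move=> <-; congr (gamma _); apply/seteqP; split => n /=.
  move=> An; split => //; rewrite /partial (eq_bigl xpredT)// => i.
  by rewrite ltn_ord.
case; rewrite /partial (eq_bigl xpredT)// => i.
by rewrite ltn_ord.
Qed.
End gaussian_projection.

(** * Supports of measures on the plane *)

Section support.
Local Open Scope ereal_scope.
Context {R : realType}.

Definition rat_box (q : (rat * rat) * (rat * rat)) : set (R * R) :=
  `]ratr q.1.1, ratr q.1.2[ `*` `]ratr q.2.1, ratr q.2.2[.

Lemma measurable_rat_box q : measurable (rat_box q).
Proof. exact: measurableX. Qed.

Lemma open_rat_box (V : set (R * R)) z : open V -> V z ->
  exists q, rat_box q z /\ rat_box q `<=` V.
Proof.
move=> oV Vz; have : nbhs z V by exact: open_nbhs_nbhs.
move=> /nbhs_ballP[e /= e0 eV].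
have rl (x : R) : (x - e < x)%R by rewrite ltrBlDr ltrDl.
have rr (x : R) : (x < x + e)%R by rewrite ltrDl.
have [a1] := rat_in_itvoo (rl z.1); have [b1] := rat_in_itvoo (rr z.1).
have [a2] := rat_in_itvoo (rl z.2); have [b2] := rat_in_itvoo (rr z.2).
rewrite !in_itv/= => /andP[? ?] /andP[? ?] /andP[? ?] /andP[? ?].
exists ((a1, b1), (a2, b2)); split.
  by split; rewrite /= in_itv/=; apply/andP; split.
move=> y [/=]; rewrite !in_itv/= => /andP[? ?] /andP[? ?].
apply: eV; split; rewrite /ball/= ltr_norml; apply/andP; split; lra.
Qed.

(** An enumeration by natural numbers of the rational boxes satisfying [P], padded with the empty
    set. *)
Definition nth_rat_box (P : set (R * R) -> Prop) (n : nat) : set (R * R) :=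
  if unpickle n is Some q then
    if `[< P (rat_box q) >] then rat_box q else set0
  else set0.

Lemma measurable_nth_rat_box P n : measurable (nth_rat_box P n).
Proof.
rewrite /nth_rat_box; case: unpickle => // q; case: ifP => // _.
exact: measurable_rat_box.
Qed.

Lemma bigcup_nth_rat_box (P : set (R * R) -> Prop) q :
  P (rat_box q) -> rat_box q `<=` \bigcup_n nth_rat_box P n.
Proof.
move=> Pq z qz; exists (pickle q); first exact: I.
by rewrite /nth_rat_box pickleK; case: asboolP.
Qed.

Lemma open_measurable_prod (V : set (R * R)) : open V -> measurable V.
Proof.
move=> oV; have -> : V = \bigcup_n nth_rat_box (fun B => B `<=` V) n.
  apply/seteqP; split => z.
    move=> Vz; have [q [qz qV]] := open_rat_box V z oV Vz.
    exact: (bigcup_nth_rat_box (fun B => B `<=` V) q).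
  move=> [n _]; rewrite /nth_rat_box; case: unpickle => // q.
  by case: asboolP => // qV; exact: qV.
by apply: bigcupT_measurable => n; exact: measurable_nth_rat_box.
Qed.

(** A Lindelof argument: each point off the support has a null open neighbourhood, hence lies in a
    null rational box, and there are countably many of these. *)
Lemma measure_off_msupp (pi : probability (R * R)%type R) (O : set (R * R)) :
  measurable O -> O `&` msupp pi = set0 -> pi O = 0.
Proof.
move=> mO O0; apply: (subset_measure0 (B := \bigcup_n nth_rat_box (fun B => pi B = 0) n)) => //.
- by apply: bigcupT_measurable => n; exact: measurable_nth_rat_box.
- move=> z Oz.
  have /existsNP[V /not_implyP[oV /not_implyP[Vz piV]]] : ~ msupp pi z.
    by move=> zs; have : (O `&` msupp pi) z by []; rewrite O0.
  have [q [qz qV]] := open_rat_box V z oV Vz.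
  apply: (bigcup_nth_rat_box (fun B => pi B = 0) q) => //.
  apply: (subset_measure0 _ _ qV) => //.
  + exact: measurable_rat_box.
  + exact: open_measurable_prod.
  + by apply/eqP; rewrite -measure_le0 leNgt; exact/negP.
- apply/eqP; rewrite -measure_le0.
  apply: (le_trans (measure_sigma_subadditive _ _ _ (@subset_refl _ _))).
  + by move=> n; exact: measurable_nth_rat_box.
  + by apply: bigcupT_measurable => n; exact: measurable_nth_rat_box.
  rewrite eseries0// => n _ _; rewrite /nth_rat_box; case: unpickle => [q|]; last exact: measure0.
  by case: asboolP => // _; exact: measure0.
Qed.

Lemma measurable_band (c : R) :
  measurable [set z : R * R | (c < `|z.1 - z.2|)%R].
Proof.
have mg : measurable_fun setT (fun z : R * R => `|z.1 - z.2|%R).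
  by apply: measurableT_comp => //; exact: measurable_funB.
have := mg measurableT `]c, +oo[%classic (measurable_itv _); rewrite setTI.
by congr measurable; apply/seteqP; split => z /=; rewrite in_itv/= andbT.
Qed.

(** Turns the supremum over the support in [W_inf] into an almost sure bound. *)
Lemma coupling_band (pi : probability (R * R)%type R) (c : R) :
  ereal_sup [set (`|z.1 - z.2|%R)%:E | z in msupp pi] <= c%:E ->
  pi [set z | (c < `|z.1 - z.2|)%R] = 0.
Proof.
move=> supc; apply: measure_off_msupp; first exact: measurable_band.
apply/seteqP; split => // z [/= cz zs].
have : (`|z.1 - z.2|%R)%:E <= c%:E.
  by apply: le_trans supc; apply: ereal_sup_ubound; exists z.
by rewrite lee_fin leNgt cz.
Qed.
End support.

(** * Inequalities for powers of densities *)

Section renyi_bound.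
Local Open Scope ereal_scope.
Context {R : realType}.
Notation leb := (@lebesgue_measure R).

(** Young's inequality for [y] and 1 with conjugate exponents [alpha] and [alpha / (alpha - 1)],
    multiplied by [alpha]. *)
Lemma bernoulli_powR (alpha y : R) : (1 < alpha)%R -> (0 <= y)%R ->
  (alpha * y <= y `^ alpha + (alpha - 1))%R.
Proof.
move=> a1 y0; have a0 : (0 < alpha)%R by lra.
have b0 : (0 < alpha - 1)%R by lra.
have q0 : (0 < alpha / (alpha - 1))%R by rewrite divr_gt0.
have pq : (alpha^-1 + (alpha / (alpha - 1))^-1 = 1)%R.
  by field; rewrite !gt_eqF.
have := conjugate_powR y0 (@ler01 R) a0 q0 pq.
rewrite mulr1 powR1 => H.
rewrite -(ler_pM2l a0) in H; apply: (le_trans H).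
by rewrite le_eqVlt; apply/orP; left; apply/eqP; field; rewrite !gt_eqF.
Qed.

(* Young's inequality: the tangent at the ratio [r] of the perspective
   [a `^ alpha * b `^ (1 - alpha)] *)
Lemma perspective_powR_tangent (alpha a b r : R) :
  (1 < alpha)%R -> (0 < a)%R -> (0 < b)%R -> (0 < r)%R ->
  (alpha * r `^ (alpha - 1) * a <=
   a `^ alpha * b `^ (1 - alpha) + (alpha - 1) * r `^ alpha * b)%R.
Proof.
move=> a1 a0 b0 r0.
have rb0 : (0 < r `^ alpha * b)%R by rewrite mulr_gt0// powR_gt0.
have y0 : (0 <= a / (r * b))%R by rewrite divr_ge0 ?mulr_ge0 ?ltW.
(* Bernoulli's inequality at [a / (r * b)], scaled by the perspective factor [r ^ alpha * b]. *)
have := bernoulli_powR alpha _ a1 y0; rewrite -(ler_pM2l rb0) => H.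
have rE : (r `^ alpha = r * r `^ (alpha - 1))%R.
  by rewrite mulr_powRB1 ?ltW//; lra.
have bE : (b `^ (1 - alpha) = b / b `^ alpha)%R.
  rewrite powRD; last by rewrite (gt_eqF b0) implybT.
  by rewrite powRr1 ?ltW// powRN.
have ba0 : (b `^ alpha != 0)%R by rewrite gt_eqF// powR_gt0.
have ra0 : (r `^ alpha != 0)%R by rewrite gt_eqF// powR_gt0.
have yE : ((a / (r * b)) `^ alpha = a `^ alpha / (r `^ alpha * b `^ alpha))%R.
  rewrite powRM ?invr_ge0 ?ltW ?mulr_gt0// -powR_inv1 ?mulr_ge0 ?ltW//.
  by rewrite -powRrM mulN1r powRN powRM ?ltW.
move: H; rewrite yE bE => H.
apply: le_trans (le_trans H _); rewrite le_eqVlt; apply/orP; left; apply/eqP.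
  by rewrite {1}rE; field; rewrite !gt_eqF.
by field; rewrite ba0 ra0.
Qed.

(** The exponents add up to 1, so completing the square in [z] leaves a single normal density and a
    factor free of [z]. *)
Lemma normal_pdf_perspective (alpha s x y z : R) : s != 0%R ->
  (normal_pdf x s z `^ alpha * normal_pdf y s z `^ (1 - alpha) =
   expR (alpha * (alpha - 1) * (x - y) ^+ 2 / (s ^+ 2 *+ 2)) *
   normal_pdf (alpha * x + (1 - alpha) * y) s z)%R.
Proof.
move=> s0; rewrite !normal_pdfE//.
have k0 : (0 <= normal_peak s)%R by exact: normal_peak_ge0.
rewrite !powRM ?normal_fun_ge0//.
rewrite mulrACA -powRD; last by rewrite (gt_eqF (normal_peak_gt0 s0)) implybT.
rewrite [(alpha + _)%R]addrC subrK powRr1// [RHS]mulrCA; congr (_ * _)%R.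
rewrite /normal_fun -!expRM -!expRD; congr expR.
by field.
Qed.


Lemma integral_marginal d1 d2 (T1 : measurableType d1) (T2 : measurableType d2)
    (pi : probability T1 R) (g : T1 -> T2) (mu : probability T2 R)
    (F : T2 -> \bar R) :
  measurable_fun setT g -> (forall A, measurable A -> pi (g @^-1` A) = mu A) ->
  measurable_fun setT F -> (forall x, 0 <= F x) ->
  \int[mu]_x F x = \int[pi]_w F (g w).
Proof.
move=> mg muE mF F0; rewrite (eq_setfun_integral mu (pushforward pi g)).
  by rewrite (ge0_integral_pushforward mg).
by move=> A mA; rewrite -muE.
Qed.

(** * The Rényi moment of two mixtures, bounded through a coupling *)

Section coupling.
Variables (mu nu : probability R R) (pi : probability (R * R)%type R).
Variables (s alpha c : R) (P Q : {measure set R -> \bar R}).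
Hypotheses (s0 : s != 0%R) (a1 : (1 < alpha)%R) (c0 : (0 <= c)%R).
Hypothesis pi_mu : forall A, measurable A -> pi (fst @^-1` A) = mu A.
Hypothesis pi_nu : forall A, measurable A -> pi (snd @^-1` A) = nu A.
Hypothesis pi_band : pi [set w | (c < `|w.1 - w.2|)%R] = 0.
Hypothesis PE : forall A, measurable A -> P A = \int[mu]_x normal_prob x s A.
Hypothesis QE : forall A, measurable A -> Q A = \int[nu]_x normal_prob x s A.

Let p := mixture_pdf mu s.
Let q := mixture_pdf nu s.
Let p0 z : (0 < p z)%R. Proof. exact: mixture_pdf_gt0. Qed.
Let q0 z : (0 < q z)%R. Proof. exact: mixture_pdf_gt0. Qed.
Let mp : measurable_fun setT p. Proof. exact: measurable_mixture_pdf. Qed.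
Let mq : measurable_fun setT q. Proof. exact: measurable_mixture_pdf. Qed.
Let h (z : R) : R := (p z / q z)%R.
Let h0 z : (0 < h z)%R. Proof. exact: divr_gt0. Qed.

Let mh : measurable_fun setT h.
Proof.
rewrite (_ : h = fun z => p z * q z `^ (-1))%R; last first.
  by apply/funext => z; rewrite powR_inv1// ltW.
apply: measurable_funM => //.
exact: (measurableT_comp (measurable_powR (-1)%R) mq).
Qed.

Let integralQ F : measurable_fun setT F -> (forall x, 0 <= F x) ->
  \int[Q]_x F x = \int[leb]_x (F x * (q x)%:E).
Proof.
move=> mF F0; apply: ge0_integral_lebesgue_density => //.
- by move=> z; exact/ltW.
- by move=> A mA; rewrite QE// mixture_density.
Qed.

Lemma ratio_density : densities P Q (EFin \o h).
Proof.
split => [|z|A mA]; first exact/measurable_EFinP.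
  by rewrite lee_fin ltW.
rewrite PE// mixture_density// [RHS]integral_mkcond integralQ; last 2 first.
- by apply/(measurable_restrictT _ mA); apply: measurable_funTS; exact/measurable_EFinP.
- by move=> z; apply: erestrict_ge0 => x _; rewrite lee_fin ltW.
rewrite integral_mkcond; apply: eq_integral => z _; rewrite !patchE.
case: ifPn => _; last by rewrite mul0e.
by rewrite /= -EFinM /h divfK// gt_eqF.
Qed.

Let K (w : R * R) : R :=
  expR (alpha * (alpha - 1) * (w.1 - w.2) ^+ 2 / (s ^+ 2 *+ 2))%R.
Let G (wz : (R * R) * R) : R :=
  (K wz.1 * normal_pdf (alpha * wz.1.1 + (1 - alpha) * wz.1.2) s wz.2)%R.

Let mK : measurable_fun setT K.
Proof.
apply: measurableT_comp => //; apply: measurable_funM => //.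
apply: measurable_funM => //; apply: measurable_funX.
exact: measurable_funB.
Qed.

Let mG : measurable_fun setT G.
Proof.
apply: measurable_funM; first exact: (measurableT_comp mK measurable_fst).
have mm : measurable_fun setT (fun wz : (R * R) * R =>
    (alpha * wz.1.1 + (1 - alpha) * wz.1.2, wz.2)%R).
  apply: measurable_fun_pair => //; apply: measurable_funD;
    by apply: measurable_funM => //; apply: measurableT_comp.
exact: (measurableT_comp (measurable_normal_pdf2 s) mm).
Qed.

Let G0 wz : (0 <= G wz)%R.
Proof. by rewrite mulr_ge0 ?expR_ge0 ?normal_pdf_ge0. Qed.

(** Joint convexity in tangent form: [perspective_powR_tangent] at the ratio [r = p z / q z] of the
    averaged densities is integrated over [pi], and this choice of [r] makes the tangent exact at
    [(p z, q z)]. *)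
Lemma ratio_power_le z :
  (h z `^ alpha * q z)%:E <= \int[pi]_w (G (w, z))%:E.
Proof.
have mGz : measurable_fun setT (fun w => (G (w, z))%:E).
  apply/measurable_EFinP.
  exact: (measurableT_comp mG (pair2_measurable z)).
have mpdf1 : measurable_fun setT (fun w : R * R => (normal_pdf w.1 s z)%:E).
  exact: (measurableT_comp (measurable_normal_pdf_mean s z) measurable_fst).
have mpdf2 : measurable_fun setT (fun w : R * R => (normal_pdf w.2 s z)%:E).
  exact: (measurableT_comp (measurable_normal_pdf_mean s z) measurable_snd).
have pE : (p z)%:E = \int[pi]_w (normal_pdf w.1 s z)%:E.
  rewrite (mixture_pdfE mu s s0 z).
  apply: (@integral_marginal _ _ _ _ pi fst mu (fun x => (normal_pdf x s z)%:E)).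
  - exact: measurable_fst.
  - exact: pi_mu.
  - exact: measurable_normal_pdf_mean.
  - by move=> x; rewrite lee_fin normal_pdf_ge0.
have qE : (q z)%:E = \int[pi]_w (normal_pdf w.2 s z)%:E.
  rewrite (mixture_pdfE nu s s0 z).
  apply: (@integral_marginal _ _ _ _ pi snd nu (fun x => (normal_pdf x s z)%:E)).
  - exact: measurable_snd.
  - exact: pi_nu.
  - exact: measurable_normal_pdf_mean.
  - by move=> x; rewrite lee_fin normal_pdf_ge0.
set r := h z.
pose k1 := (alpha * r `^ (alpha - 1))%R.
pose k2 := ((alpha - 1) * r `^ alpha)%R.
have a0 : (0 < alpha)%R by exact: lt_trans a1.
have k10 : (0 <= k1)%R by rewrite mulr_ge0 ?powR_ge0// ltW.
have k20 : (0 <= k2)%R by rewrite mulr_ge0 ?powR_ge0// subr_ge0 ltW.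
have H : k1%:E * (p z)%:E <= \int[pi]_w (G (w, z))%:E + k2%:E * (q z)%:E.
  rewrite pE qE -!ge0_integralZl//; last 2 first.
  - by move=> w _; rewrite lee_fin normal_pdf_ge0.
  - by move=> w _; rewrite lee_fin normal_pdf_ge0.
  rewrite -ge0_integralD//; last 3 first.
  - by move=> w _; rewrite lee_fin.
  - by move=> w _; rewrite -EFinM lee_fin mulr_ge0 ?normal_pdf_ge0.
  - exact: measurable_funeM.
  apply: ge0_le_integral => //.
  - by move=> w _; rewrite -EFinM lee_fin mulr_ge0 ?normal_pdf_ge0.
  - exact: measurable_funeM.
  - by apply: emeasurable_funD => //; exact: measurable_funeM.
  - move=> w _; rewrite -!EFinM -EFinD lee_fin /G /= /K -normal_pdf_perspective//.
    exact: (perspective_powR_tangent _ _ _ _ a1 (normal_pdf_gt0 _ _ _ s0)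
      (normal_pdf_gt0 _ _ _ s0) (h0 z)).
(* Since [p z = r * q z], the left side of [H] contains the finite term [k2 * q z] of the right
   side, which cancels. *)
have E1 : (k1 * p z = r `^ alpha * q z + k2 * q z)%R.
  have -> : (p z = r * q z)%R by rewrite /r /h divfK// gt_eqF.
  rewrite /k1 /k2.
  have -> : (r `^ alpha = r * r `^ (alpha - 1))%R.
    by rewrite (mulr_powRB1 (ltW (h0 z)) a0).
  by ring.
move: H; rewrite -!EFinM E1 EFinD leeD2rE//.
Qed.

(** The infimum is at most its value at the density [p / q]. After Tonelli the inner integral of [G]
    in [z] is [K w], and [|w.1 - w.2| <= c] for [pi]-almost every [w]. *)
Lemma renyi_moment_coupling_le :
  renyi_moment alpha P Q <=
  (expR (alpha * (alpha - 1) * c ^+ 2 / (s ^+ 2 *+ 2)))%:E.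
Proof.
apply: (@le_trans _ _ (\int[Q]_z poweR ((EFin \o h) z) alpha)).
  by apply: ereal_inf_lbound; exists (EFin \o h) => //; exact: ratio_density.
rewrite integralQ; last 2 first.
- apply: (measurableT_comp (measurable_poweR alpha)).
  exact/measurable_EFinP.
- by move=> z; exact: poweR_ge0.
apply: (@le_trans _ _ (\int[leb]_z \int[pi]_w (G (w, z))%:E)).
  apply: ge0_le_integral => //.
  - by move=> z _; rewrite mule_ge0 ?poweR_ge0// lee_fin ltW.
  - apply: emeasurable_funM; last exact/measurable_EFinP.
    apply: (measurableT_comp (measurable_poweR alpha)).
    exact/measurable_EFinP.
  - apply: (@measurable_fun_fubini_tonelli_G _ _ _ (measurableTypeR R) R pi
      (fun wz => (G wz)%:E)) => //.
    exact/measurable_EFinP.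
  - by move=> z _; rewrite /= -EFinM; exact: ratio_power_le.
have mG' : measurable_fun setT (fun wz => (G wz)%:E) by exact/measurable_EFinP.
have G0' wz : 0 <= (G wz)%:E by rewrite lee_fin.
rewrite -(@fubini_tonelli _ _ _ (measurableTypeR R) R pi leb _ mG' G0').
have mband : measurable [set w : R * R | (c < `|w.1 - w.2|)%R].
  exact: measurable_band.
have e0 : (0 < s ^+ 2 *+ 2)%R by rewrite pmulrn_lgt0// exprn_even_gt0.
apply: (@integral_le_full_measure _ _ _ pi (~` [set w | (c < `|w.1 - w.2|)%R])).
- exact: measurableC.
- by have := probability_setC pi mband; rewrite pi_band sube0.
- by move=> w; apply: integral_ge0 => z _; rewrite lee_fin.
- exact: expR_ge0.
move=> w /= /negP; rewrite -leNgt => wc.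
rewrite (_ : integral _ _ _ = \int[leb]_z ((K w)%:E *
    (normal_pdf (alpha * w.1 + (1 - alpha) * w.2) s z)%:E)); last first.
  by apply: eq_integral => z _; rewrite -EFinM.
rewrite ge0_integralZl//=; last 3 first.
- by apply/measurable_EFinP; exact: measurable_normal_pdf.
- by move=> x _; rewrite lee_fin normal_pdf_ge0.
- by rewrite lee_fin expR_ge0.
rewrite integral_normal_pdf mule1 lee_fin ler_expR ler_pM2r ?invr_gt0//.
rewrite ler_wpM2l//; first by rewrite mulr_ge0 ?subr_ge0 ?ltW// (lt_trans _ a1).
by rewrite -[leLHS]real_normK ?num_real// lerXn2r ?nnegrE.
Qed.
End coupling.
End renyi_bound.

(** * Couplings from [W_inf], and the case of distance zero *)

Section wasserstein_zero.
Local Open Scope ereal_scope.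
Context {R : realType}.

Lemma W_inf_coupling (mu nu : set R -> \bar R) (c : R) : W_inf mu nu < c%:E ->
  exists pi : probability (R * R)%type R,
    [/\ forall A, measurable A -> pi (fst @^-1` A) = mu A,
        forall A, measurable A -> pi (snd @^-1` A) = nu A &
        pi [set z | (c < `|z.1 - z.2|)%R] = 0].
Proof.
move=> /ereal_inf_lt[_ [pi pic <-] supc]; exists pi; split.
- move=> A mA; have [<- _] := pic A mA; congr (pi _).
  by apply/seteqP; split => [z //|z []].
- move=> A mA; have [_ <-] := pic A mA; congr (pi _).
  by apply/seteqP; split => [z //|z []].
- exact/coupling_band/ltW.
Qed.

(** [f] and [g] stand for the two projections in either order, so that one inequality serves both
    directions. The open ray is exhausted by closed rays with margin [1 / (n + 1)]; a coupling that
    moves points by at most half this margin sends the closed ray into the open one, up to a null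
    set. *)
Lemma ray_le (mu nu : probability R R) (x : R) :
  (forall e : R, (0 < e)%R -> exists pi : probability (R * R)%type R,
    exists f g : R * R -> R,
    [/\ measurable_fun setT f, measurable_fun setT g,
        forall A, measurable A -> pi (f @^-1` A) = mu A,
        forall A, measurable A -> pi (g @^-1` A) = nu A &
        pi [set z | (e < `|f z - g z|)%R] = 0]) ->
  mu `]x, +oo[%classic <= nu `]x, +oo[%classic.
Proof.
move=> H; pose F n : set R := `[(x + n.+1%:R^-1)%R, +oo[%classic.
have FE : `]x, +oo[%classic = \bigcup_n F n by rewrite itvoyEbigcup.
have Fle n : mu (F n) <= nu `]x, +oo[%classic.
  have e0 : (0 < n.+1%:R^-1 / 2 :> R)%R by rewrite divr_gt0 ?invr_gt0 ?ltr0n.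
  have [pi [f [g [mf mg pf pg band]]]] := H _ e0.
  rewrite -pf; last exact: measurable_itv.
  rewrite -pg; last exact: measurable_itv.
  have mF1 : measurable (f @^-1` F n).
    by rewrite -[X in measurable X]setTI; apply: mf => //; exact: measurable_itv.
  have mG1 : measurable (g @^-1` `]x, +oo[%classic).
    by rewrite -[X in measurable X]setTI; apply: mg => //; exact: measurable_itv.
  pose B := [set z | (n.+1%:R^-1 / 2 < `|f z - g z|)%R].
  have mB : measurable B.
    have mfg : measurable_fun setT (fun z : R * R => `|f z - g z|%R).
      by apply: measurableT_comp => //; exact: measurable_funB.
    have := mfg measurableT `](n.+1%:R^-1 / 2)%R, +oo[%classic (measurable_itv _).
    rewrite setTI; congr measurable.
    by apply/seteqP; split => z /=; rewrite in_itv/= andbT.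
  apply: (@le_trans _ _ (pi ((g @^-1` `]x, +oo[%classic) `|` B))).
    apply: le_measure; rewrite ?inE//; first exact: measurableU.
    move=> z /=; rewrite /F/= in_itv/= andbT => fz.
    have [Bz|/negP Bz] := pselect (B z); [by right|left].
    rewrite in_itv/= andbT; move: Bz; rewrite -leNgt ler_norml => /andP[_ fg].
    by move: fg fz e0; move: (n.+1%:R^-1)%R => i fg fz e0; lra.
  apply: (le_trans (measureU2 _ _ _)) => //.
  by rewrite [X in _ + X]band adde0.
have cF : mu \o F @ \oo --> mu `]x, +oo[%classic.
  rewrite FE; apply: nondecreasing_cvg_mu.
  - by move=> n; exact: measurable_itv.
  - by rewrite -FE; exact: measurable_itv.
  - move=> m n mn; apply/subsetPset => z; rewrite /F/= !in_itv/= !andbT.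
    by apply: le_trans; rewrite lerD2l lef_pV2 ?posrE ?ltr0n// ler_nat ltnS.
rewrite -(cvg_lim _ cF)//; apply: lime_le; first by apply/cvg_ex; eexists; exact: cF.
by apply: nearW => n; exact: Fle.
Qed.

(** Open rays form a pi-system that generates the Borel sets. *)
Lemma probability_eq_rays (mu nu : probability R R) :
  (forall x, mu `]x, +oo[%classic = nu `]x, +oo[%classic) ->
  forall A, measurable A -> mu A = nu A.
Proof.
move=> H A mA; apply: (measure_unique (@RGenOInfty.G R)
  (fun n => `](- n%:R)%R, +oo[%classic)) => //.
- exact: RGenOInfty.measurableE.
- move=> _ _ [x ->] [y ->]; exists (Num.max x y).
  apply/seteqP; split => z /=; rewrite !in_itv/= !andbT gt_max.
    by move=> [-> ->].
  by move/andP.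
- by move=> n; exists (- n%:R)%R.
- apply/seteqP; split => // x _; exists (Num.truncn `|x|).+1 => //=.
  rewrite in_itv/= andbT ltrNl; apply: le_lt_trans (truncnS_gt _).
  by rewrite -normrN ler_norm.
- by move=> _ [x ->]; exact: H.
- by move=> k; rewrite (le_lt_trans (probability_le1 _ _))// ?ltry.
Qed.

(** Couplings with arbitrarily small displacement exist, and they give both inequalities on rays,
    the second one with the projections swapped. *)
Lemma W_inf_eq0 (mu nu : probability R R) : W_inf mu nu <= 0 ->
  forall A, measurable A -> mu A = nu A.
Proof.
move=> W0; apply: probability_eq_rays => x.
have C (e : R) : (0 < e)%R -> W_inf mu nu < e%:E.
  by move=> e0; rewrite (le_lt_trans W0)// lte_fin.
apply/eqP; rewrite eq_le; apply/andP; split; apply: ray_le => e e0.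
  have [pi [pm pn pb]] := W_inf_coupling _ _ _ (C e e0).
  by exists pi, fst, snd.
have [pi [pm pn pb]] := W_inf_coupling _ _ _ (C e e0).
exists pi, snd, fst; split => //.
by under eq_set do rewrite distrC.
Qed.
End wasserstein_zero.

(** * The Rényi moment in terms of [W_inf] *)

Section renyi_moment.
Local Open Scope ereal_scope.
Context {R : realType}.

Lemma eq_renyi_moment (alpha : R) (P P' Q Q' : set R -> \bar R) :
  (forall A, measurable A -> P A = P' A) ->
  (forall A, measurable A -> Q A = Q' A) ->
  renyi_moment alpha P Q = renyi_moment alpha P' Q'.
Proof.
move=> PP QQ; rewrite /renyi_moment; congr ereal_inf.
have -> : densities P Q = densities P' Q'.
  apply/seteqP; split => h [mh h0 H]; split => // A mA.
    by rewrite -PP// H//; exact: eq_setfun_integral.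
  by rewrite PP// H//; apply/esym; exact: eq_setfun_integral.
by apply/seteqP; split => _ [h dh <-]; exists h => //;
  apply: eq_setfun_integral => A mA; rewrite QQ.
Qed.

Lemma renyi_moment_eq (alpha : R) (P Q : probability R R) :
  (forall A, measurable A -> P A = Q A) -> renyi_moment alpha P Q <= 1.
Proof.
move=> PQ; apply: (@le_trans _ _ (\int[Q]_x poweR (cst 1 x) alpha)).
  apply: ereal_inf_lbound; exists (cst 1) => //; split => // A mA.
  by rewrite integral_cst// mul1e PQ.
rewrite /= powR1 integral_cst// mul1e.
by rewrite [leLHS](probability_setT Q).
Qed.

(* [c] ranges over all reals above [D], hence the bound with [D] itself *)
Lemma renyi_moment_W_inf (alpha s D : R) (mu nu : probability R R)
    (P Q : {measure set R -> \bar R}) :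
  s != 0%R -> (1 < alpha)%R -> (0 <= D)%R -> W_inf mu nu <= D%:E ->
  (forall A, measurable A -> P A = \int[mu]_x normal_prob x s A) ->
  (forall A, measurable A -> Q A = \int[nu]_x normal_prob x s A) ->
  renyi_moment alpha P Q <=
    (expR (alpha * (alpha - 1) * D ^+ 2 / (s ^+ 2 *+ 2)))%:E.
Proof.
move=> s0 a1 D0 WD PE QE.
set B := expR _; apply/lee_addgt0Pr => e e0.
pose k := (alpha * (alpha - 1) / (s ^+ 2 *+ 2))%R.
have k0 : (0 < k)%R.
  rewrite divr_gt0 ?pmulrn_lgt0 ?exprn_even_gt0//.
  by rewrite mulr_gt0 ?subr_gt0// (lt_trans _ a1).
have BE : B = expR (k * D ^+ 2) by rewrite /B /k mulrAC.
have B0 : (0 < B)%R by rewrite BE expR_gt0.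
have L : (k * D ^+ 2 < ln (B + e))%R.
  by rewrite -ltr_expR lnK ?posrE ?addr_gt0// -BE ltrDl.
(* Chosen so that the coupling bound at [c] is exactly [B + e]; the slack [e] forces [D < c]. *)
pose c := Num.sqrt (ln (B + e) / k).
have Lk0 : (0 <= ln (B + e) / k)%R.
  rewrite divr_ge0// ltW// (le_lt_trans _ L)// mulr_ge0 ?sqr_ge0//.
  exact: ltW.
have c2 : (c ^+ 2 = ln (B + e) / k)%R by rewrite sqr_sqrtr.
have c0 : (0 <= c)%R by exact: sqrtr_ge0.
have Dc : (D < c)%R.
  by rewrite -(@ltr_pXn2r _ 2)// ?nnegrE// c2 ltr_pdivlMr// mulrC.
have Wc : W_inf mu nu < c%:E by rewrite (le_lt_trans WD)// lte_fin.
have [pi [pm pn pb]] := W_inf_coupling mu nu c Wc.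
have := @renyi_moment_coupling_le R mu nu pi s alpha c P Q s0 a1 c0 pm pn pb PE QE.
have -> : (alpha * (alpha - 1) * c ^+ 2 / (s ^+ 2 *+ 2) = ln (B + e))%R.
  by rewrite mulrAC -/k c2 mulrC divfK// gt_eqF.
by rewrite lnK ?posrE ?addr_gt0.
Qed.
End renyi_moment.

(** * Conditional laws given a secret *)

Section conditional_law.
Local Open Scope ereal_scope.
Context {R : realType} {dS dX : measure_display} {S : measurableType dS}
  {X : measurableType dX}.

(** Restrict [theta] to the fibre over [s], project to [X], and normalise. *)
Lemma cond_law_probability (theta : probability (S * X)%type R) (s : S) :
  measurable [set s] -> 0 < PS theta s ->
  exists P : probability X R, forall A, measurable A -> cond_law theta s A = P A.
Proof.
move=> ms PS0.
have mfib : measurable ([set s] `*` [set: X]) by exact: measurableX.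
pose m : {measure set X -> \bar R} :=
  image_measure (mrestr theta mfib) _ (@measurable_snd _ _ S X).
have mE A : m A = theta ([set s] `*` A).
  rewrite /m /= /image_measure /pushforward /= /mrestr; congr (theta _).
  by apply/seteqP; split => [[a b] [/= ? []]|[a b] []].
have mT : m setT = PS theta s by rewrite mE.
(* The second argument of [mnormalize] is its default for a total mass that is zero or infinite,
   excluded by [PS0] and [PSfin]. *)
exists (mnormalize m (image_prob theta _ (@measurable_snd _ _ S X))) => A mA.
have PSfin : PS theta s \is a fin_num by exact: fin_num_measure.
rewrite /= /mnormalize mT gt_eqF//= lt_eqF ?ltey_eq ?PSfin//.
change (cond_law theta s A = m A * ((fine (PS theta s))^-1)%:E).
by rewrite mE /cond_law EFinM fineK// fin_num_measure//; exact: measurableX.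
Qed.
End conditional_law.

(** * Slices of the mechanism *)

Section mechanism.
Local Open Scope ereal_scope.
Context {R : realType} {dS dX : measure_display} {S : measurableType dS}
  {X : measurableType dX} {d : nat}.

Lemma measurable_Psi (u : d.-tuple R) : measurable_fun setT (Psi u).
Proof. exact: (measurable_sum_tnth d u xpredT). Qed.

Lemma Psi_addv (u a b : d.-tuple R) : Psi u (Defs.addv a b) = (Psi u a + Psi u b)%R.
Proof.
rewrite /Psi /inner -big_split/=; apply: eq_bigr => i _.
by rewrite tnth_mktuple mulrDl.
Qed.

(** The factor 1 keeps the shift in the shape [x + v * t] of the affine lemmas. *)
Lemma measurable_gauss1_shift (s2 : R) (A : set R) : (0 <= s2)%R -> measurable A ->
  measurable_fun setT (fun x : R => gauss1 s2 [set t | A (x + 1 * t)%R]).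
Proof.
move=> s20 mA; have [s2E|s2n0] := eqVneq s2 0%R.
  under eq_fun do rewrite gauss1_affine_degenerate ?s2E ?mulr0//.
  by apply/measurable_EFinP; exact: measurable_indic.
have s2gt0 : (0 < s2)%R by rewrite lt_neqAle eq_sym s2n0.
under eq_fun => x do rewrite (gauss1_affine x 1%R s2 A (oner_neq0 _) s2gt0 mA).
by apply: measurable_normal_prob => //; rewrite expr1n mul1r gt_eqF// sqrtr_gt0.
Qed.

(** [Psi u] is additive, and the projected noise has variance exactly [s2] because [u] lies on the
    unit sphere. *)
Lemma mech_law_slice (f : X -> d.-tuple R) (gamma : probability (d.-tuple R) R)
    (s2 : R) (u : d.-tuple R) (theta : probability (S * X)%type R) (s : S)
    (P : probability X R) (mf : measurable_fun setT (Psi u \o f)) :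
  (0 <= s2)%R -> is_gaussian_iso gamma s2 -> @sphere R d u ->
  (forall A, measurable A -> cond_law theta s A = P A) ->
  forall A, measurable A ->
  pushforward (mech_law f gamma theta s) (Psi u) A =
  \int[image_prob P _ mf]_x gauss1 s2 [set t | A (x + 1 * t)%R].
Proof.
move=> s20 gE su cE A mA.
rewrite (ge0_integral_pushforward mf) => //; last first.
  exact: measurable_gauss1_shift.
rewrite preimage_setT /pushforward /mech_law (eq_setfun_integral _ P)//.
apply: eq_integral => x _ /=.
have mshift : measurable [set t | A (Psi u (f x) + 1 * t)%R].
  by rewrite -[X in measurable X]setTI; apply: measurable_affine.
have := gaussian_projection d gamma s2 s20 gE u _ mshift.
rewrite su mulr1 => <-; congr (gamma _).
by apply/seteqP; split => n /=; rewrite Psi_addv mul1r.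
Qed.

Lemma slice_renyi_moment_le (f : X -> d.-tuple R)
    (gamma : probability (d.-tuple R) R) (alpha eps D : R) (u : d.-tuple R)
    (theta : probability (S * X)%type R) (si sj : S) :
  (1 < alpha)%R -> (0 < eps)%R -> (0 <= D)%R ->
  (forall s : S, measurable [set s]) -> measurable_fun setT f ->
  is_gaussian_iso gamma (alpha * D ^+ 2 / (2 * eps)) -> @sphere R d u ->
  0 < PS theta si -> 0 < PS theta sj ->
  W_inf (pushforward (query_law f theta si) (Psi u))
        (pushforward (query_law f theta sj) (Psi u)) <= D%:E ->
  renyi_moment alpha (pushforward (mech_law f gamma theta si) (Psi u))
    (pushforward (mech_law f gamma theta sj) (Psi u)) <=
  (expR ((alpha - 1) * eps))%:E.
Proof.
move=> a1 e0 D0 mS mf gE su PSi PSj WD.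
have [Pi PiE] := cond_law_probability theta si (mS si) PSi.
have [Pj PjE] := cond_law_probability theta sj (mS sj) PSj.
have muf : measurable_fun setT (Psi u \o f).
  by apply: measurableT_comp => //; exact: measurable_Psi.
have a0 : (0 < alpha)%R by exact: lt_trans a1.
set s2 := (alpha * D ^+ 2 / (2 * eps))%R in gE.
have s20 : (0 <= s2)%R.
  by rewrite divr_ge0 ?mulr_ge0 ?sqr_ge0// ltW// mulr_gt0.
(* Every coupling of the sliced query laws is a coupling of these image probabilities, so the
   infimum can only decrease. *)
have {}WD : W_inf (image_prob Pi _ muf) (image_prob Pj _ muf) <= D%:E.
  apply: le_trans WD; apply: le_ereal_inf => _ [pi pic <-]; exists pi => // A mA.
  have mA' : measurable ((Psi u \o f) @^-1` A).
    by rewrite -[X in measurable X]setTI; exact: muf.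
  by have [-> ->] := pic A mA; split; [exact: PiE|exact: PjE].
have LE s P PE := mech_law_slice f gamma s2 u theta s P muf s20 gE su PE.
have [D_eq0|Dn0] := eqVneq D 0%R.
  have s2_eq0 : s2 = 0%R by rewrite /s2 D_eq0 expr0n mulr0 mul0r.
  have dE s (P : probability X R) :
      (forall A, measurable A -> cond_law theta s A = P A) ->
      forall A, measurable A ->
      pushforward (mech_law f gamma theta s) (Psi u) A = image_prob P _ muf A.
    move=> PE A mA; rewrite (LE s P PE A mA).
    under eq_integral do rewrite gauss1_affine_degenerate ?s2_eq0 ?mulr0//.
    refine (etrans (integral_indic (image_prob P _ muf) measurableT mA) _).
    by rewrite setIT.
  rewrite (@eq_renyi_moment _ _ _ _ _ _ (dE si Pi PiE) (dE sj Pj PjE)).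
  apply: (le_trans (renyi_moment_eq _ _ _ _)); last first.
    by rewrite lee_fin -[leLHS]expR0 ler_expR mulr_ge0 ?subr_ge0 ?ltW.
  by apply: W_inf_eq0; move: WD; rewrite D_eq0.
have Dgt0 : (0 < D)%R by rewrite lt_neqAle eq_sym Dn0.
have s2gt0 : (0 < s2)%R by rewrite divr_gt0 ?mulr_gt0 ?exprn_gt0.
have madd : measurable_fun setT (fun z : R * R => z.1 + 1 * z.2)%R.
  by apply: measurable_funD => //; exact: measurable_funM.
(* The sliced output law as the image of a product measure under addition, which supplies the
   measure structure required by [renyi_moment_W_inf]. *)
pose M (P : probability X R) :=
  image_measure (image_prob P _ muf \x gauss1 s2) _ madd.
have ME P A : measurable A ->
    M P A = \int[image_prob P _ muf]_x gauss1 s2 [set t | A (x + 1 * t)%R].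
  move=> mA; apply: eq_integral => x _ /=; congr (gauss1 s2 _).
  by apply/seteqP; split => t; rewrite /xsection/= inE.
have sE : ((Num.sqrt s2) ^+ 2 = s2)%R by rewrite sqr_sqrtr.
have sn0 : Num.sqrt s2 != 0%R by rewrite gt_eqF// sqrtr_gt0.
have MN P A : measurable A ->
    M P A = \int[image_prob P _ muf]_x normal_prob x (Num.sqrt s2) A.
  move=> mA; rewrite ME//; apply: eq_integral => x _.
  rewrite (gauss1_affine x 1%R s2 A (oner_neq0 _) s2gt0 mA).
  by rewrite expr1n mul1r.
have LM s (P : probability X R) :
    (forall A, measurable A -> cond_law theta s A = P A) ->
    forall A, measurable A ->
    pushforward (mech_law f gamma theta s) (Psi u) A = M P A.
  by move=> PE A mA; rewrite (LE s P PE A mA) ME.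
rewrite (@eq_renyi_moment _ _ _ _ _ _ (LM si Pi PiE) (LM sj Pj PjE)).
(* For this variance [alpha (alpha - 1) D^2 / (2 s2)] simplifies to [(alpha - 1) eps]. *)
have := renyi_moment_W_inf alpha _ _ _ _ (M Pi) (M Pj) sn0 a1 D0 WD (MN Pi) (MN Pj).
congr (_ <= (expR _)%:E); rewrite sE /s2; field.
by rewrite Dn0 !gt_eqF.
Qed.
End mechanism.

(** * From Rényi moments to the joint divergence *)

Section jsd.
Local Open Scope ereal_scope.
Context {R : realType}.

(** On nonnegative moments [expeR] inverts [lne]. As [P] and [Q] are bare set functions, a negative
    moment is treated apart: there [lne] is [-oo] and its exponential is 0. *)
Lemma expeR_renyi_le dT (T : measurableType dT) (alpha c : R)
    (P Q : set T -> \bar R) :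
  (1 < alpha)%R -> (0 <= c)%R -> renyi_moment alpha P Q <= c%:E ->
  expeR ((alpha - 1)%:E * renyi alpha P Q) <= c%:E.
Proof.
move=> a1 c0 mc; rewrite /renyi muleA -EFinM divff ?mul1e; last first.
  by rewrite gt_eqF// subr_gt0.
have [m0|m0] := leP 0 (renyi_moment alpha P Q).
  by rewrite (_ : expeR _ = renyi_moment alpha P Q)//; apply/eqP; rewrite lneK_eq.
by rewrite (le0_lneNy (ltW m0)) lee_fin.
Qed.

Lemma sqr_le_ereal (x : \bar R) (D : R) : (0 <= D)%R ->
  x * x <= (D ^+ 2)%:E -> x <= D%:E.
Proof.
move=> D0; case: x => [r| |].
- rewrite -EFinM !lee_fin -expr2 => rD.
  rewrite (le_trans (ler_norm r))// -(@ler_pXn2r _ 2)// ?nnegrE//.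
  by rewrite real_normK// num_real.
- by rewrite mulyy leye_eq.
- by rewrite leNye.
Qed.

Lemma JSD_le (d : nat) (alpha eps : R) (omega : probability (d.-tuple R) R)
    (V : set (d.-tuple R)) (P Q : set (d.-tuple R) -> \bar R) :
  (1 < alpha)%R -> measurable V -> omega V = 1 ->
  (forall u, V u -> renyi_moment alpha (pushforward P (Psi u))
    (pushforward Q (Psi u)) <= (expR ((alpha - 1) * eps))%:E) ->
  JSD alpha omega P Q <= eps%:E.
Proof.
move=> a1 mV oV H; rewrite /JSD.
have b0 : (0 < alpha - 1)%R by rewrite subr_gt0.
set J := \int[omega]_u _.
have J0 : 0 <= J by apply: integral_ge0 => u _; exact: expeR_ge0.
have Jle : J <= expeR ((alpha - 1) * eps)%:E.
  apply: (@integral_le_full_measure _ _ _ omega V) => //.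
  - by move=> u; exact: expeR_ge0.
  - by move=> u Vu; apply: expeR_renyi_le => //; exact: H.
rewrite lee_pdivrMl// -EFinM -[leRHS]expeRK lee_lne//.
- by rewrite in_itv/= J0 leey.
- by rewrite in_itv/= lee_fin expR_ge0 leey.
Qed.
End jsd.

(** * Privacy of the isotropic Gaussian mechanism *)

Theorem theorem2 (R : realType) (dS dX : measure_display)
  (S : measurableType dS) (X : measurableType dX)
  (Q : set (S * S)%type) (Theta : set (probability (S * X)%type R))
  (d : nat) (U : set (d.-tuple R)) (omega : probability (d.-tuple R) R)
  (alpha eps : R) (f : X -> d.-tuple R) (Dstar2 : R)
  (gamma : probability (d.-tuple R) R) :
  (* secrets: the events {S = s} are measurable, so P^S_theta(s) makes sense *)
  (forall s : S, measurable [set s]) ->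
  (* slice profile (U, omega): U subset of the unit sphere, omega supported on U *)
  U `<=` @sphere R d ->
  (exists V, [/\ measurable V, V `<=` U & omega V = 1%E]) ->
  1 < alpha -> 0 < eps ->
  (* the query f : X -> R^d *)
  measurable_fun setT f ->
  (* Delta_star^2 = sup_{u in U} (Delta^u_infty)^2 (finite) *)
  Dstar2%:E = ereal_sup [set (Delta_inf Q Theta f u * Delta_inf Q Theta f u)%E
                        | u in U] ->
  (* N ~ N(0, alpha Delta_star^2 / (2 eps) I_d) *)
  is_gaussian_iso gamma (alpha * Dstar2 / (2 * eps)) ->
  (* M(X) = f(X) + N, N independent of (S, X), is (alpha,eps,omega)-Joint-SRPP *)
  joint_SRPP alpha eps omega Q Theta (mech_law f gamma).
Proof.
move=> mS Usphere [V [mV VU oV]] a1 e0 mf DstarE gE theta si sj Ttheta Qij PSi PSj.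
(* A set of full mass is nonempty; a direction in it shows that [Dstar2] dominates a square, hence
   is nonnegative and has the square root [D]. *)
have [u0 Vu0] : V !=set0.
  apply/set0P/eqP => V0; move: oV; rewrite V0 measure0 => /eqP.
  by rewrite eq_sym onee_eq0.
have Delta2_le u : U u ->
    (Delta_inf Q Theta f u * Delta_inf Q Theta f u <= Dstar2%:E)%E.
  by move=> Uu; rewrite DstarE; apply: ereal_sup_ubound; exists u.
have Dstar2_ge0 : 0 <= Dstar2.
  rewrite -lee_fin; apply: le_trans (Delta2_le u0 (VU _ Vu0)).
  have [D0|D0] := leP 0%E (Delta_inf Q Theta f u0); first exact: mule_ge0.
  by rewrite mule_le0// ltW.
pose D := Num.sqrt Dstar2.
have D2 : D ^+ 2 = Dstar2 by rewrite sqr_sqrtr.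
have D0 : 0 <= D by exact: sqrtr_ge0.
have gE' : is_gaussian_iso gamma (alpha * D ^+ 2 / (2 * eps)) by rewrite D2.
apply: (JSD_le _ _ _ _ V) => // u Vu.
apply: (slice_renyi_moment_le f gamma alpha eps D u theta si sj a1 e0 D0 mS mf
  gE' (Usphere u (VU u Vu)) PSi PSj).
apply: (@le_trans _ _ (Delta_inf Q Theta f u)).
  by apply: ereal_sup_ubound; exists theta, si, sj.
apply: sqr_le_ereal => //.
by rewrite D2; exact/Delta2_le/VU.
Qed.
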